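(* The class $\mathbb D$ of all one-point convergence spaces is productive.
   Context: One-point convergence spaces: for a (non-empty) directed poset $D$ and an element $\infty\notin D$, let $\beta_D$ be the topology on $D\cup\{\infty\}$ having as a subbase all sets $\uparrow x$ and $\uparrow x\cup\{\infty\}$, $x\in D$, where $\uparrow x=\{y\in D:x\le y\}$. The spaces $(D\cup\{\infty\},\beta_D)$ are the one-point convergence spaces. For a class $\mathbb C$ of $T_0$ spaces, a subset $U$ of a $T_0$ space $X$ is $\mathbb C$-open if $k^{-1}(U)$ is open in $C$ for every $C\in\mathbb C$ and every continuous map $k:C\to X$; $X$ is $\mathbb C$-generated if every $\mathbb C$-open subset is open. A space $X$ is core compact if for every open $V$ and $x\in V$ there is an open $U$ with $x\in U\ll V$, where $U\ll V$ means that every open cover of $V$ has a finite subfamily covering $U$. $\mathbb C$ is productive if every space in $\mathbb C$ is core compact and every topological product $C_1\times C_2$ with $C_1,C_2\in\mathbb C$ is $\mathbb C$-generated. *)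

(* Defs.v *)
From HB Require Import structures.
From mathcomp Require Import all_boot all_order finmap.
From mathcomp Require Import all_classical all_analysis.
Set Implicit Arguments.
Unset Strict Implicit.
Unset Printing Implicit Defensive.
Import Order.TTheory.
Local Open Scope classical_set_scope.
Local Open Scope order_scope.

Definition directed d (D : porderType d) : Prop :=
  [set: D] !=set0 /\ forall x y : D, exists z, x <= z /\ y <= z.

(* The carrier D ∪ {∞}, with [None] in the role of the new element ∞. *)
Definition one_point d (D : porderType d) : Type := option D.

Section OnePoint.
Context d (D : porderType d).

HB.instance Definition _ := Choice.on (one_point D).

Definition upset (x : D) : set (one_point D) := Some @` [set y | x <= y].

Definition one_point_subbase : set (set (one_point D)) :=
  range upset `|` range (fun x => upset x `|` [set None]).

HB.instance Definition _ :=
  isSubBaseTopological.Build (one_point D) one_point_subbase id.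

End OnePoint.

Definition homeomorphic (X Y : topologicalType) : Prop :=
  exists (f : X -> Y) (g : Y -> X),
    [/\ cancel f g, cancel g f, continuous f & continuous g].

(* Homeomorphic copies are included because both the underlying set and the
   element ∞ are arbitrary: a bijection from [one_point D] transports the
   order of D and the point ∞ along with the topology. *)
Definition one_point_convergence_space (X : topologicalType) : Prop :=
  exists (d : Order.disp_t) (D : porderType d),
    directed D /\ homeomorphic (one_point D) X.

Record T0_class := T0Class {
  T0_class_pred :> topologicalType -> Prop;
  T0_class_kolmogorov : forall X, T0_class_pred X -> kolmogorov_space X }.

Section Generated.
Variable C : T0_class.

Definition class_open (X : topologicalType) (U : set X) : Prop :=
  forall Y : topologicalType, C Y ->
  forall k : Y -> X, continuous k -> open (k @^-1` U).

Definition class_generated (X : topologicalType) : Prop :=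
  forall U : set X, class_open U -> open U.

End Generated.

Definition way_below (X : topologicalType) (U V : set X) : Prop :=
  forall F : set (set X), F `<=` open -> V `<=` \bigcup_(W in F) W ->
  finite_subset_cover F id U.

Definition core_compact (X : topologicalType) : Prop :=
  forall (V : set X) (x : X), open V -> V x ->
  exists U : set X, [/\ open U, U x & way_below U V].

Definition productive (C : T0_class) : Prop :=
  (forall X : topologicalType, C X -> core_compact X) /\
  (forall X Y : topologicalType, C X -> C Y ->
     class_generated C (X * Y)%type).

Lemma one_point_subbase_open d (D : porderType d) (A : set (one_point D)) :
  one_point_subbase A -> open A.
Proof.
move=> bA; exists [set A]; last by rewrite bigcup_set1.
move=> _ ->; exists [fset A]%fset; last by rewrite set_fset1 bigcap_set1.
by move=> B; rewrite in_fset1 => /eqP BA; rewrite inE BA.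
Qed.

Lemma one_point_kolmogorov d (D : porderType d) :
  kolmogorov_space (one_point D).
Proof.
have up (a : D) (y : one_point D) : ~ upset a y ->
    exists A : set (one_point D), A \in nbhs (Some a : one_point D) /\ y \in ~` A.
  move=> ay; exists (upset a); split; rewrite inE //.
  apply: open_nbhs_nbhs; split; last by exists a; first exact: lexx.
  by apply: one_point_subbase_open; left; exists a.
move=> [a|] [b|] // ab.
- have [leab|nab] := boolP (a <= b).
  + have [|A ?] := up b (Some a); last by exists A; right.
    move=> [c /= bc [ca]]; move: ab; rewrite -ca.
    have -> : c = b by apply/le_anti; rewrite bc ca leab.
    by rewrite eqxx.
  + have [|A ?] := up a (Some b); last by exists A; left.
    by move=> [c /= ac [cb]]; move: nab; rewrite -cb ac.
- by have [[]//|A ?] := up a None; exists A; left.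
- by have [[]//|A ?] := up b None; exists A; right.
Qed.

Lemma one_point_convergence_space_T0 (X : topologicalType) :
  one_point_convergence_space X -> kolmogorov_space X.
Proof.
move=> [d [D [_ [f [g [_ gK _ cg]]]]]] x y xy.
have gxy : g x != g y by apply: contra_neq xy => /(can_inj gK).
have [A []] := one_point_kolmogorov gxy; rewrite !inE => -[nA yA];
  exists (g @^-1` A); [left|right]; rewrite !inE; split=> //; exact: cg.
Qed.

Definition one_point_convergence_class : T0_class :=
  T0Class one_point_convergence_space_T0.

(* Main.v *)
Require Import Defs.
From mathcomp Require Import all_boot all_order finmap.
From mathcomp Require Import all_classical all_analysis.
Set Implicit Arguments.
Unset Strict Implicit.
Unset Printing Implicit Defensive.
Import Order.TTheory.
Local Open Scope classical_set_scope.
Local Open Scope order_scope.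

(** The open sets of [one_point D], for [D] directed, are governed by two facts:
    they are upward closed on [D] ([open_upward]), and those that contain [None]
    also meet [D] ([open_infty_meets]).  So [Some x] has the smallest
    neighbourhood [upset x], and the sets [upset x `|` [set None]] form a base of
    neighbourhoods of [None].

    Core compactness.  These basic neighbourhoods are determined by at most two
    points: an open set containing [Some x] contains all of [upset x].  Hence if a
    basic neighbourhood lies in [V], any open cover of [V] covers it by one member
    containing [Some x] and, if needed, one member containing [None].

    Products.  Let [U] be open for the class in [one_point D * one_point E].
    Testing [U] against the map that sends [None] to [p] and everything else to [q],
    which is continuous as soon as [q] lies in all open sets containing [p], shows
    that [U] is upward closed for the specialization order
    ([convergence_open_upward]).  Testing it against the slices [fun c => (c, b)]
    and [fun c => (a, c)] shows that [None] can be replaced by some [Some x] in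
    either coordinate of a point of [U].  By upward closure, a box of basic
    neighbourhoods is contained in [U] as soon as its finitely many lowest points
    are, and such a box exists around each point of [U].  At [(None, None)] the four
    points [(Some x, Some y)], [(Some x, None)], [(None, Some y)], [(None, None)]
    are needed: [x] is chosen with [U (Some x, None)], and then directedness of [E]
    gives one [y] that serves both for [Some x] and for [None]. *)

(** * Open sets of a one-point convergence space *)

Section OnePoint.
Context d (D : porderType d).
Implicit Types (x y : D) (A U : set (one_point D)).

Lemma upsetE x y : upset x (Some y) = (x <= y) :> Prop.
Proof.
by apply/propext; split=> [[z /= xz [<-]]|xy]; [exact: xz|exists y].
Qed.

Lemma upset_None x : ~ upset x None.
Proof. by case. Qed.

Lemma open_upset x : open (upset x : set (one_point D)).
Proof. by apply: one_point_subbase_open; left; exists x. Qed.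

Lemma open_upset_infty x : open (upset x `|` [set None] : set (one_point D)).
Proof. by apply: one_point_subbase_open; right; exists x. Qed.

Lemma subbase_upward A x y :
  one_point_subbase A -> x <= y -> A (Some x) -> A (Some y).
Proof.
move=> [[a _ <-]|[a _ <-]] xy; first by rewrite !upsetE => /le_trans; apply.
by case=> // ax; left; move: ax; rewrite !upsetE => /le_trans; apply.
Qed.

(** Unfolds the topology generated by the subbase into a form that allows
    induction on the finite list of subbasic sets. *)
Lemma open_finite_subbase U (p : one_point D) :
  open U -> U p -> exists s : seq (set (one_point D)),
    (forall A, A \in s -> one_point_subbase A /\ A p) /\
    (forall q, (forall A, A \in s -> A q) -> U q).
Proof.
move=> [F sF <-] [B FB Bp]; have [J sJ BJ] := sF _ FB.
exists (enum_fset J); split=> [A JA|q Jq].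
  split; first by apply: set_mem; exact: sJ.
  by move: Bp; rewrite -BJ; apply.
suff Bq : B q by exists B.
by rewrite -BJ => A JA; exact: Jq.
Qed.

Lemma open_upward U x y : open U -> x <= y -> U (Some x) -> U (Some y).
Proof.
move=> oU xy /(open_finite_subbase oU)[s [sx sU]]; apply: sU => A /sx[bA].
exact: subbase_upward.
Qed.

Hypothesis dirD : directed D.

(** A subbasic set containing [None] has the form [upset a `|` [set None]];
    an upper bound of finitely many such [a] lies in all of these sets. *)
Lemma open_infty_meets U : open U -> U None -> exists x, U (Some x).
Proof.
have [[x0 _] dir] := dirD => oU /(open_finite_subbase oU)[s [sub sU]].
suff [x xP] : exists x, forall A, A \in s -> A (Some x).
  by exists x; exact: sU.
elim: s sub {sU} => [|A s IHs] sub; first by exists x0.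
have [y ys] : exists x, forall A, A \in s -> A (Some x).
  by apply: IHs => A' sA'; apply: sub; rewrite inE sA' orbT.
have [[[a _ Aa]|[a _ Aa]] Ai] := sub A (mem_head _ _).
  by move: Ai; rewrite -Aa => /upset_None.
have [z [az yz]] := dir a y; exists z => A'; rewrite inE => /predU1P[->|sA'].
  by rewrite -Aa; left; rewrite upsetE.
apply: (subbase_upward _ yz (ys _ sA')).
by apply: (sub _ _).1; rewrite inE sA' orbT.
Qed.

End OnePoint.

(** * Core compactness *)

(** Two members of a cover of [V], one around [a] and one around [b], already
    cover [U]. *)
Lemma way_below_two_points (X : topologicalType) (U V : set X) (a b : X) :
  V a -> V b ->
  (forall A B : set X, open A -> open B -> A a -> B b -> U `<=` A `|` B) ->
  way_below U V.
Proof.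
move=> Va Vb UAB F oF VF; have [A FA Aa] := VF _ Va; have [B FB Bb] := VF _ Vb.
exists [fset A; B]%fset.
  by move=> W; rewrite !inE => /orP[] /eqP ->.
move=> u Uu; have [Au|Bu] := UAB A B (oF _ FA) (oF _ FB) Aa Bb u Uu.
  by exists A => //=; rewrite !inE eqxx.
by exists B => //=; rewrite !inE eqxx orbT.
Qed.

(** The argument is carried out in [X] itself, with the basic neighbourhoods
    transported along [g]. *)
Lemma one_point_core_compact (X : topologicalType) :
  one_point_convergence_space X -> core_compact X.
Proof.
move=> [d [D [dirD [f [g [fK gK /continuousP cf /continuousP cg]]]]]] V u oV Vu.
case gu : (g u) => [x|]; move: Vu; rewrite -(gK u) gu => Vu.
  exists (g @^-1` upset x); split.
  - by apply: cg; exact: open_upset.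
  - by rewrite /preimage/= fK upsetE.
  - apply: (way_below_two_points Vu Vu) => A B oA _ Ax _ v; rewrite /preimage /=.
    rewrite -(gK v) fK; case: (g v) => [y|/upset_None//]; rewrite upsetE => xy.
    by left; exact: (open_upward (cf _ oA) xy).
have [x Vx] := open_infty_meets dirD (cf _ oV) Vu.
exists (g @^-1` (upset x `|` [set None])); split.
- by apply: cg; exact: open_upset_infty.
- by rewrite /preimage/= fK; right.
- apply: (way_below_two_points Vx Vu) => A B oA oB Ax Bi v; rewrite /preimage /=.
  rewrite -(gK v) fK; case: (g v) => [y [|//]|_]; last by right.
  by rewrite upsetE => xy; left; exact: (open_upward (cf _ oA) xy).
Qed.

(** * Specialization, products and homeomorphisms *)

(** The specialization order, oriented so that open sets are upward closed. *)
Definition spec_le (X : topologicalType) (p q : X) :=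
  forall O : set X, open O -> O p -> O q.

Section Slices.
Context (X Y : topologicalType).

Lemma slice_l_continuous (y : Y) : continuous (fun x : X => (x, y)).
Proof. by move=> x; apply: cvg_pair; [exact: cvg_id|exact: cvg_cst]. Qed.

Lemma slice_r_continuous (x : X) : continuous (fun y : Y => (x, y)).
Proof. by move=> y; apply: cvg_pair; [exact: cvg_cst|exact: cvg_id]. Qed.

(** Change one coordinate at a time: the slices of an open set of the product
    through a fixed coordinate are open. *)
Lemma spec_le_pair (a a' : X) (b b' : Y) :
  spec_le a a' -> spec_le b b' -> spec_le (a, b) (a', b').
Proof.
move=> aa' bb' O oO Oab.
have /continuousP/(_ _ oO) oOb := @slice_l_continuous b.
have /continuousP/(_ _ oO) oOa' := @slice_r_continuous a'.
exact: (bb' _ oOa' (aa' _ oOb Oab)).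
Qed.

Lemma nbhs_box (A : set X) (B : set Y) (a : X) (b : Y) (U : set (X * Y)) :
  open A -> open B -> A a -> B b -> A `*` B `<=` U -> nbhs (a, b) U.
Proof.
by move=> oA oB Aa Bb ABU; exists (A, B) => //; split; apply: open_nbhs_nbhs.
Qed.

End Slices.

Lemma spec_le_refl (X : topologicalType) (p : X) : spec_le p p.
Proof. by []. Qed.

Lemma spec_le_upward d (D : porderType d) (x y : D) :
  x <= y -> spec_le (Some x : one_point D) (Some y).
Proof. by move=> xy O oO; exact: open_upward. Qed.

Lemma spec_le_upset d (D : porderType d) (x : D) (c : one_point D) :
  upset x c -> spec_le (Some x : one_point D) c.
Proof.
by case: c => [y|/upset_None//]; rewrite upsetE; exact: spec_le_upward.
Qed.

Lemma homeomorphic_refl (X : topologicalType) : homeomorphic X X.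
Proof. by exists id, id; split=> // x; exact: cvg_id. Qed.

Lemma homeomorphic_prod (X X' Y Y' : topologicalType) :
  homeomorphic X X' -> homeomorphic Y Y' ->
  homeomorphic (X * Y)%type (X' * Y')%type.
Proof.
move=> [f [g [fK gK cf cg]]] [f' [g' [fK' gK' cf' cg']]].
have cprod (S S' T T' : topologicalType) (h : S -> S') (h' : T -> T') :
    continuous h -> continuous h' -> continuous (fun p => (h p.1, h' p.2)).
  move=> ch ch' p; apply: cvg_pair.
    exact: (continuous_comp cvg_fst (ch _)).
  exact: (continuous_comp cvg_snd (ch' _)).
exists (fun p => (f p.1, f' p.2)), (fun p => (g p.1, g' p.2)).
split; [| |exact: cprod|exact: cprod].
  by move=> [a b] /=; rewrite fK fK'.
by move=> [a b] /=; rewrite gK gK'.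
Qed.

(** Composing test maps with [f] makes the pullback of a [C]-open set [C]-open. *)
Lemma class_generated_homeomorphic (C : T0_class) (X Y : topologicalType) :
  homeomorphic X Y -> class_generated C X -> class_generated C Y.
Proof.
move=> [f [g [_ gK cf /continuousP cg]]] genX U CU.
have -> : U = g @^-1` (f @^-1` U).
  by apply/seteqP; split=> y; rewrite /preimage /= gK.
apply: cg; apply: genX => Z CZ k ck; apply: (CU Z CZ (f \o k)) => z.
by apply: continuous_comp; [exact: ck|exact: cf].
Qed.

(** * Sets open for the class of one-point convergence spaces *)

Local Notation convergence_open := (class_open one_point_convergence_class).

Lemma one_point_in_class d (D : porderType d) :
  directed D -> one_point_convergence_class (one_point D).
Proof. by move=> dirD; exists d, D; split=> //; exact: homeomorphic_refl. Qed.

Lemma open_finite_part d (D : porderType d) :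
  open (~` [set None] : set (one_point D)).
Proof.
have -> : ~` [set None] = \bigcup_x (upset x : set (one_point D)).
  apply/seteqP; split=> [[x _|/(_ erefl)//]|[x _ //|[x _ /upset_None//]]].
  by exists x => //; rewrite upsetE.
by apply: bigcup_open => x _; exact: open_upset.
Qed.

(** The test map sends [None] to [p] and all of [D] to [q].  The preimage of an open
    set is then empty, everything, or the complement of [None]: it cannot be
    [set None] alone, because of [spec_le p q].  The preimage of [U] contains
    [None], hence meets [D], where the map takes the value [q]. *)
Lemma convergence_open_upward d (D : porderType d) (X : topologicalType)
    (U : set X) (p q : X) :
  directed D -> convergence_open U -> spec_le p q -> U p -> U q.
Proof.
move=> dirD CU pq Up.
pose k (c : one_point D) := if c is Some _ then q else p.
suff ck : continuous k.
  have [x] := open_infty_meets dirD (CU _ (one_point_in_class dirD) k ck) Up.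
  exact.
apply/continuousP => O oO.
have [Oq|nOq] := pselect (O q); last first.
  have -> : k @^-1` O = set0.
    by apply/seteqP; split=> // -[x|] //= /(pq O oO).
  exact: open0.
have [Op|nOp] := pselect (O p).
  have -> : k @^-1` O = setT by apply/seteqP; split=> // -[x|].
  exact: openT.
have -> : k @^-1` O = ~` [set None].
  by apply/seteqP; split=> [[x|]|[x|/(_ erefl)]].
exact: open_finite_part.
Qed.

Lemma one_point_prod_generated d (D : porderType d) e (E : porderType e) :
  directed D -> directed E ->
  class_generated one_point_convergence_class (one_point D * one_point E)%type.
Proof.
move=> dirD dirE U CU.
have up a a' b b' : spec_le a a' -> spec_le b b' ->
    U (a, b) -> U (a', b').
  by move=> aa' bb'; apply: (convergence_open_upward dirD CU);
    exact: spec_le_pair.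
have tail_l b : U (None, b) -> exists x, U (Some x, b).
  apply: (@open_infty_meets _ _ dirD ((fun c => (c, b)) @^-1` U)).
  exact/(CU _ (one_point_in_class dirD))/slice_l_continuous.
have tail_r a : U (a, None) -> exists y, U (a, Some y).
  apply: (@open_infty_meets _ _ dirE ((fun c => (a, c)) @^-1` U)).
  exact/(CU _ (one_point_in_class dirE))/slice_r_continuous.
rewrite openE => -[[x|] [y|]] Uxy; rewrite /interior /=.
- apply: (nbhs_box (open_upset x) (open_upset y)); rewrite ?upsetE//.
  move=> [c c'] [/= /spec_le_upset xc /spec_le_upset yc'].
  exact: (up _ _ _ _ xc yc' Uxy).
- have [y Uxy'] := tail_r _ Uxy.
  apply: (nbhs_box (open_upset x) (open_upset_infty y));
    rewrite ?upsetE//; first by right.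
  move=> [c c'] [/= /spec_le_upset xc [/spec_le_upset yc'|->]].
    exact: (up _ _ _ _ xc yc' Uxy').
  exact: (up _ _ _ _ xc (@spec_le_refl _ _) Uxy).
- have [x Ux'y] := tail_l _ Uxy.
  apply: (nbhs_box (open_upset_infty x) (open_upset y));
    rewrite ?upsetE//; first by right.
  move=> [c c'] [/= [/spec_le_upset xc|->] /spec_le_upset yc'].
    exact: (up _ _ _ _ xc yc' Ux'y).
  exact: (up _ _ _ _ (@spec_le_refl _ _) yc' Uxy).
(* The common upper bound [y] keeps both [(None, Some y)] and [(Some x, Some y)]
   in [U]; asking for [x] and [y] independently would lose the latter. *)
have [x Ux] := tail_l _ Uxy; have [y0 Uy0] := tail_r _ Uxy.
have [y1 Uxy1] := tail_r _ Ux; have [y [y0y y1y]] := dirE.2 y0 y1.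
have Uy : U (None, Some y).
  exact: (up _ _ _ _ (@spec_le_refl _ _) (spec_le_upward y0y) Uy0).
have {y1 y1y Uxy1}Uxy' : U (Some x, Some y).
  exact: (up _ _ _ _ (@spec_le_refl _ _) (spec_le_upward y1y) Uxy1).
apply: (nbhs_box (open_upset_infty x) (open_upset_infty y)); try by right.
move=> [c c'] [/= [/spec_le_upset xc|->] [/spec_le_upset yc'|->]] //.
- exact: (up _ _ _ _ xc yc' Uxy').
- exact: (up _ _ _ _ xc (@spec_le_refl _ _) Ux).
- exact: (up _ _ _ _ (@spec_le_refl _ _) yc' Uy).
Qed.

Theorem proposition13 : productive one_point_convergence_class.
Proof.
split=> [X|X Y]; first exact: one_point_core_compact.
move=> [d [D [dirD DX]]] [e [E [dirE EY]]].
apply: class_generated_homeomorphic (homeomorphic_prod DX EY) _.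
exact: one_point_prod_generated.
Qed.
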